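(* Let $r\in\mathbb{N}$ with $r\ge1$, and let $a\in\mathbb{N}^n$ and $b\in\mathbb{N}^m$ with $a$ nonincreasing, $\max_i b_i\le rn$, and $\sum_{i\le n} a_i=\sum_{i\le m} b_i$. For $k\in\{1,\dots,n\}$ let $(\mathrm{B}_k)$ denote the inequality $$\sum_{i\le k}a_i\le\sum_{i\le m}\min\{rk,b_i\}.$$ The following are equivalent: (1) there exists a bipartite $r$-multigraph with degrees $(a,b)$; (2) $a\trianglelefteq b^B$; (3) $(\mathrm{B}_k)$ holds for all $k\in\{1,\dots,n\}$; (4) $(\mathrm{B}_k)$ holds for all $k\in C(a)$ such that $k<\max_i b_i/r$; (5) $j\,a'_j+\sum_{i>j}a'_i\le\sum_{i\le r a'_j}b'_i$ for all $j\in C(a')$ such that $a'_j<\max_i b_i/r$.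
   Context: $\mathbb{N}=\{0,1,2,\dots\}$. A bipartite $r$-multigraph is a bipartite graph in which multiple edges are allowed, but with at most $r$ edges connecting each pair of vertices; it has degrees $(a,b)$ if its two parts have $n$ and $m$ vertices with degree sequences $a$ and $b$ respectively (edges counted with multiplicity). For $c\in\mathbb{N}^p$, the conjugate $c'=(c'_1,c'_2,\dots)$ is $c'_k=\#\{i:c_i\ge k\}$. For nonnegative integer sequences $x,y$ (finite ones extended by zeros), $x\trianglelefteq y$ means $\sum_{i\le k}x_i\le\sum_{i\le k}y_i$ for all $k\ge1$. For matrices $A,B\in\mathbb{N}^{m\times n}$, $A\trianglelefteq B$ means that the vectors $\alpha,\beta\in\mathbb{N}^n$ of column sums of $A,B$ satisfy $\alpha\trianglelefteq\beta$; if a finite set $S\subset\mathbb{N}^{m\times n}$ has a unique maximal element with respect to $\trianglelefteq$, the generalized conjugate of $S$ is the vector of column sums of this maximal element. The sequence $b^B\in\mathbb{N}^n$ is the generalized conjugate of the set of matrices in $\mathbb{N}^{m\times n}$ with row sums $b$ and all entries at most $r$ (it exists when $\max_i b_i\le rn$); explicitly, $\sum_{i\le k}b^B_i=\sum_{i\le m}\min\{rk,b_i\}=\sum_{i\le rk}b'_i$ for $k\in\{1,\dots,n\}$. For a nonincreasing $x\in\mathbb{N}^p$, the set of corners is $C(x)=\{k:1\le k\le p,\ x_k>x_{k+1}\}$ with the convention $x_{p+1}=0$; likewise $C(a')=\{j\ge1:a'_j>a'_{j+1}\}$. *)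

(* Defs.v *)
From mathcomp Require Import all_boot all_order all_algebra.

Set Implicit Arguments.
Unset Strict Implicit.
Unset Printing Implicit Defensive.

(* The sequences [x_1, x_2, ...] are indexed from 1 throughout, so [term x 0]
   is a dummy value.  Finite sequences are extended by zeros. *)
Definition term (x : seq nat) (k : nat) : nat := nth 0 x k.-1.

Definition psum (x : seq nat) (k : nat) : nat := \sum_(1 <= i < k.+1) term x i.

Definition nonincreasing (x : seq nat) : bool := sorted geq x.

Definition dominated (x y : seq nat) : Prop :=
  forall k, 0 < k -> psum x k <= psum y k.

Definition conj_seq (c : seq nat) (k : nat) : nat := count (fun x => k <= x) c.

Lemma conj_seq_eq0 (c : seq nat) (k : nat) :
  \max_(x <- c) x < k -> conj_seq c k = 0.
Proof.
move=> ck; apply/eqP; rewrite -leqn0 leqNgt -has_count -all_predC.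
apply/allP=> x xc /=; rewrite -ltnNge; apply: leq_ltn_trans ck.
exact: (leq_bigmax_seq (F := id)).
Qed.

(* The infinite sum of the [conj_seq c i] over all [i > j]; by [conj_seq_eq0]
   all the terms with [i] larger than the maximum of [c] vanish. *)
Definition conj_tail (c : seq nat) (j : nat) : nat :=
  \sum_(j.+1 <= i < (\max_(x <- c) x).+1) conj_seq c i.

Definition corner (x : seq nat) (k : nat) : bool :=
  (1 <= k <= size x) && (term x k.+1 < term x k).

Definition conj_corner (c : seq nat) (j : nat) : bool :=
  (1 <= j) && (conj_seq c j.+1 < conj_seq c j).

Definition col_sums (m n : nat) (A : 'M[nat]_(m, n)) : n.-tuple nat :=
  [tuple \sum_(i < m) A i j | j < n].

Definition mx_dominated (m n : nat) (A B : 'M[nat]_(m, n)) : Prop :=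
  dominated (col_sums A) (col_sums B).

(* [mx_dominated] is only a preorder, so maximality of [M] is stated without
   antisymmetry: whatever dominates [M] is dominated by [M]. *)
Definition maximal_in (m n : nat) (S : 'M[nat]_(m, n) -> Prop)
    (M : 'M[nat]_(m, n)) : Prop :=
  S M /\ forall A, S A -> mx_dominated M A -> mx_dominated A M.

Definition generalized_conjugate (m n : nat) (S : 'M[nat]_(m, n) -> Prop)
    (c : n.-tuple nat) : Prop :=
  exists2 M : 'M[nat]_(m, n), unique (maximal_in S) M & c = col_sums M.

Definition bounded_mx (m n r : nat) (b : m.-tuple nat) (A : 'M[nat]_(m, n)) :
    Prop :=
  (forall i, \sum_(j < n) A i j = tnth b i) /\ (forall i j, A i j <= r).

(* [b^B], as a relation: [is_bB r b c] means that the generalized conjugate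
   exists and is equal to [c]. *)
Definition is_bB (m n r : nat) (b : m.-tuple nat) (c : n.-tuple nat) : Prop :=
  generalized_conjugate (bounded_mx r b) c.

Record bip_multigraph (n m : nat) := BipMultigraph {
  edge : finType;
  lend : edge -> 'I_n;
  rend : edge -> 'I_m
}.

Definition multiplicity n m (G : bip_multigraph n m) (i : 'I_n) (j : 'I_m) :=
  #|[set e : edge G | (lend e == i) && (rend e == j)]|.

Definition ldegree n m (G : bip_multigraph n m) (i : 'I_n) : nat :=
  #|[set e : edge G | lend e == i]|.

Definition rdegree n m (G : bip_multigraph n m) (j : 'I_m) : nat :=
  #|[set e : edge G | rend e == j]|.

Definition is_r_multigraph (r n m : nat) (G : bip_multigraph n m) : Prop :=
  forall i j, multiplicity G i j <= r.

Definition has_degrees n m (G : bip_multigraph n m)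
    (a : n.-tuple nat) (b : m.-tuple nat) : Prop :=
  (forall i, ldegree G i = tnth a i) /\ (forall j, rdegree G j = tnth b j).

Definition ineqB (r n m : nat) (a : n.-tuple nat) (b : m.-tuple nat) (k : nat) :
    Prop :=
  psum a k <= \sum_(i < m) minn (r * k) (tnth b i).

Definition below_ratio (k M r : nat) : Prop := (k%:R < M%:R / r%:R :> rat)%R.

(* Main.v *)
(* Filling each row greedily from the left, with entries [r], [r], ..., [r] and a
   remainder, gives the unique maximal matrix; its [k]-th prefix of column sums is
   the right-hand side of (B_k).  Starting from that matrix, units are moved to
   the right inside rows until the column sums are [a], which realizes [a] as soon
   as every (B_k) holds.  Since the right-hand side of (B_k) is concave in [k],
   its difference with the prefix sums of [a] can only go below zero if it does so
   at a corner of [a].  Finally [a] and its conjugate count the cells of the same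
   Young diagram, which turns corners of [a] into corners of the conjugate. *)
Require Import Defs.
From mathcomp Require Import all_boot all_order all_algebra.
From mathcomp Require Import zify.

Set Implicit Arguments.
Unset Strict Implicit.
Unset Printing Implicit Defensive.

Lemma below_ratioP (k M r : nat) : 0 < r -> below_ratio k M r <-> r * k < M.
Proof.
move=> r0; rewrite /below_ratio Num.Theory.ltr_pdivlMr ?Num.Theory.ltr0n //.
by rewrite -GRing.natrM Num.Theory.ltr_nat mulnC.
Qed.

(** * Prefix sums of finite sequences *)

Lemma psum_ord (x : seq nat) (k : nat) : psum x k = \sum_(i < k) nth 0 x i.
Proof. by rewrite /psum big_add1 big_mkord. Qed.

Lemma sum_ord_restrict (n k : nat) (F : nat -> nat) :
  \sum_(i < n | i < k) F i = \sum_(i < minn k n) F i.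
Proof.
case: leqP => [kn|nk]; first exact/esym/big_ord_widen.
by apply: eq_bigl => i; rewrite (ltn_trans _ nk).
Qed.

Lemma sum_nth_restrict (x : seq nat) (n k : nat) : size x <= n ->
  \sum_(i < k) nth 0 x i = \sum_(i < n | i < k) nth 0 x i.
Proof.
move=> xn; rewrite sum_ord_restrict; case: leqP => // nk.
rewrite -!(big_mkord xpredT) (big_cat_nat (n := n)) ?(ltnW nk) //=.
rewrite [X in _ + X]big_nat [X in _ + X]big1 ?addn0 // => i /andP[ni _].
by rewrite nth_default // (leq_trans xn).
Qed.

Lemma psum_tuple (n : nat) (t : n.-tuple nat) (k : nat) :
  psum t k = \sum_(i < n | i < k) tnth t i.
Proof.
rewrite psum_ord (@sum_nth_restrict _ n) ?size_tuple //.
by apply: eq_bigr => i _; rewrite (tnth_nth 0).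
Qed.

(** * Conjugates and corners of a Young diagram *)

Lemma sum_leq_indicator (K x : nat) : \sum_(1 <= i < K.+1) (i <= x) = minn K x.
Proof.
elim: K => [|K IH]; first by rewrite big_geq // min0n.
by rewrite big_nat_recr //= IH; lia.
Qed.

Lemma sum_conj_seq (c : seq nat) (p q : nat) :
  \sum_(p <= i < q) conj_seq c i = \sum_(x <- c) \sum_(p <= i < q) (i <= x).
Proof.
rewrite exchange_big /=; apply: eq_bigr => i _.
by rewrite /conj_seq -sum1_count big_mkcond; apply: eq_bigr => x _; case: leqP.
Qed.

Lemma conj_tailE (c : seq nat) (j : nat) :
  conj_tail c j = \sum_(x <- c) (x - j).
Proof.
rewrite /conj_tail sum_conj_seq big_seq [RHS]big_seq; apply: eq_bigr => x xc.
have: x <= \max_(y <- c) y by exact: (leq_bigmax_seq (F := id)).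
move: (\max_(y <- c) y) => M xM.
case: (leqP j M) => jM; last by rewrite big_geq; lia.
have := sum_leq_indicator M x; rewrite (big_cat_nat (n := j.+1)) //=.
by rewrite sum_leq_indicator; lia.
Qed.

(** By monotonicity the entries at least [j] form an initial segment. Positivity of [j] keeps the
    default 0 past the end from counting. *)
Lemma leq_nth_conj_seq (a : seq nat) (i j : nat) : nonincreasing a -> 0 < j ->
  (j <= nth 0 a i) = (i < conj_seq a j).
Proof.
rewrite /nonincreasing /conj_seq => + j0.
elim: a i => [|x s IH] i /=; first by rewrite nth_nil; lia.
rewrite path_sortedE; last by move=> ? ? ? /=; lia.
case/andP=> /allP xs ss; case: (leqP j x) => jx.
  by case: i => [|i] /=; rewrite ?jx // IH.
have -> : count (leq j) s = 0.
  apply/eqP; rewrite -leqn0 leqNgt -has_count -all_predC.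
  by apply/allP=> y /xs /=; lia.
case: i => [|i] /=; first by lia.
apply/negbTE; rewrite -ltnNge.
have [si|si] := leqP (size s) i; first by rewrite nth_default.
by have /= := xs _ (mem_nth 0 si); lia.
Qed.

Lemma nonincreasing_nth (a : seq nat) (p q : nat) : nonincreasing a -> p <= q ->
  nth 0 a q <= nth 0 a p.
Proof.
move=> a_noninc pq; case: (posnP (nth 0 a q)) => [-> //|q0].
rewrite leq_nth_conj_seq // (leq_ltn_trans pq) //.
by rewrite -leq_nth_conj_seq.
Qed.

(** The first [conj_seq a j] entries are exactly those at least [j], and each such entry [x] splits
    as [j + (x - j)]. This identifies the left sides of (5) and (B_k). *)
Lemma psum_conj_seq (a : seq nat) (j : nat) : nonincreasing a -> 0 < j ->
  psum a (conj_seq a j) = j * conj_seq a j + conj_tail a j.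
Proof.
move=> a_noninc j0; rewrite psum_ord (sum_nth_restrict _ (leqnn (size a))).
have -> : j * conj_seq a j = \sum_(x <- a) (j <= x) * j.
  rewrite /conj_seq -sum1_count big_distrr /= big_mkcond.
  by apply: eq_bigr => x _; case: leqP; lia.
rewrite conj_tailE -big_split (big_nth 0) big_mkord big_mkcond.
apply: eq_bigr => i _; rewrite -leq_nth_conj_seq //=.
by case: leqP; lia.
Qed.

Lemma corner_conj_seq (a : seq nat) (j : nat) : nonincreasing a ->
  conj_corner a j -> corner a (conj_seq a j).
Proof.
move=> a_noninc /andP[j0 jc]; have k0 : 0 < conj_seq a j by lia.
rewrite /corner k0 count_size /term /=.
have := leq_nth_conj_seq (conj_seq a j).-1 a_noninc j0.
have := leq_nth_conj_seq (conj_seq a j) a_noninc j0.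
by lia.
Qed.

(** A corner cell of the diagram is determined by its column [k] or by its height [term a k]; this
    direction recovers (4) from (5). *)
Lemma conj_corner_term (a : seq nat) (k : nat) : nonincreasing a ->
  corner a k -> conj_corner a (term a k) /\ conj_seq a (term a k) = k.
Proof.
move=> a_noninc /andP[/andP[k0 _]]; rewrite /conj_corner /term /= => ak.
have j0 : 0 < nth 0 a k.-1 by lia.
have := leq_nth_conj_seq k.-1 a_noninc j0.
have := leq_nth_conj_seq k a_noninc j0.
have := leq_nth_conj_seq k.-1 a_noninc (ltn0Sn (nth 0 a k.-1)).
by lia.
Qed.

(* Downwards from a failure at [k] the function [s] stays constant (a drop is a
   point where the inequality is assumed), while [t] can only grow, so the
   failure would propagate down to [k = 0]. *)
Lemma leq_sum_from_drops (s t : nat -> nat) (n : nat) :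
    {homo s : x y / x <= y >-> y <= x} ->
    {homo t : x y / x <= y >-> y <= x} ->
    \sum_(i < n) s i <= \sum_(i < n) t i ->
    (forall k, 0 < k < n -> s k < s k.-1 ->
       \sum_(i < k) s i <= \sum_(i < k) t i) ->
  forall k, k <= n -> \sum_(i < k) s i <= \sum_(i < k) t i.
Proof.
move=> s_dec t_dec st_n st_drop.
have below k : k < n -> s k < t k -> \sum_(i < k) s i <= \sum_(i < k) t i.
  elim: k => [|k IH] kn stk; first by rewrite !big_ord0.
  have [drop|flat] := ltnP (s k.+1) (s k); first exact: st_drop.
  have tk := t_dec k k.+1 (leqnSn k).
  by have := IH; rewrite !big_ord_recr /=; lia.
(* Induction downwards from [n]: if [t <= s] at the last index, removing that index preserves the
   inequality; otherwise [below] applies. *)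
move=> k kn; rewrite -(subKn kn).
elim: (n - k) (leq_subr k n) => [|d IH] dn; first by rewrite subn0.
have [st|ts] := ltnP (s (n - d.+1)) (t (n - d.+1)).
  by apply: below st; lia.
have := IH (ltnW dn); have -> : n - d = (n - d.+1).+1 by lia.
by rewrite !big_ord_recr /=; lia.
Qed.

(** * The greedy matrix and its maximality *)

Definition greedy_mx (m n r : nat) (b : m.-tuple nat) : 'M[nat]_(m, n) :=
  \matrix_(i, j) minn r (tnth b i - r * j).

Lemma sum_minn_sub (r x k : nat) :
  \sum_(j < k) minn r (x - r * j) = minn (r * k) x.
Proof.
elim: k => [|k IH]; first by rewrite big_ord0 muln0 min0n.
by rewrite big_ord_recr /= IH mulnS; lia.
Qed.

Lemma greedy_mx_row (m n r : nat) (b : m.-tuple nat) (i : 'I_m) (k : nat) :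
    tnth b i <= r * n ->
  \sum_(j < n | j < k) greedy_mx n r b i j = minn (r * k) (tnth b i).
Proof.
move=> bn; under eq_bigr do rewrite mxE.
rewrite (sum_ord_restrict _ _ (fun j => minn r (tnth b i - r * j))).
(* For [k > n] both caps [r * n] and [r * k] reach the row sum. *)
by rewrite sum_minn_sub; case: (leqP k n) => kn //; nia.
Qed.

Lemma psum_col_sums (m n : nat) (A : 'M[nat]_(m, n)) (k : nat) :
  psum (col_sums A) k = \sum_(i < m) \sum_(j < n | j < k) A i j.
Proof.
rewrite psum_tuple exchange_big /=; apply: eq_bigr => j _.
by rewrite tnth_mktuple.
Qed.

Lemma row_psum_le (m n r : nat) (b : m.-tuple nat) (A : 'M[nat]_(m, n))
    (i : 'I_m) (k : nat) : bounded_mx r b A ->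
  \sum_(j < n | j < k) A i j <= minn (r * k) (tnth b i).
Proof.
case=> Ab Ar; rewrite leq_min; apply/andP; split; last first.
  by rewrite -Ab [leqRHS](bigID (fun j : 'I_n => j < k)) leq_addr.
apply: (@leq_trans (\sum_(j < n | j < k) r)); first exact: leq_sum.
rewrite (sum_ord_restrict _ _ (fun=> r)) sum_nat_const card_ord mulnC leq_mul //.
exact: geq_minl.
Qed.

Lemma psum_col_sums_le (m n r : nat) (b : m.-tuple nat) (A : 'M[nat]_(m, n))
    (k : nat) : bounded_mx r b A ->
  psum (col_sums A) k <= \sum_(i < m) minn (r * k) (tnth b i).
Proof.
by move=> Ab; rewrite psum_col_sums; apply: leq_sum => i _; exact: row_psum_le.
Qed.

Lemma eq_of_leq_sum (I : finType) (F G : I -> nat) :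
    (forall i, F i <= G i) -> \sum_i G i <= \sum_i F i ->
  forall i, F i = G i.
Proof.
move=> FG GF i; apply/eqP; rewrite eqn_leq FG /=.
move: GF; rewrite (bigD1 i) //= [leqRHS](bigD1 i) //=.
have : \sum_(j | j != i) F j <= \sum_(j | j != i) G j by exact: leq_sum.
by lia.
Qed.

Section Greedy.

Variables (m n r : nat) (b : m.-tuple nat).
Hypothesis b_max : \max_(i < m) tnth b i <= r * n.

Let b_le i : tnth b i <= r * n.
Proof. exact: leq_trans (leq_bigmax i) b_max. Qed.

Lemma greedy_mx_bounded : bounded_mx r b (greedy_mx n r b).
Proof.
split=> i; last by move=> j; rewrite mxE geq_minl.
have := greedy_mx_row n (b_le i); rewrite (minn_idPr (b_le i)) => <-.
by apply: eq_bigl => j; rewrite ltn_ord.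
Qed.

Lemma psum_greedy_mx k :
  psum (col_sums (greedy_mx n r b)) k = \sum_(i < m) minn (r * k) (tnth b i).
Proof.
by rewrite psum_col_sums; apply: eq_bigr => i _; exact: greedy_mx_row.
Qed.

(* Equality of all prefix sums of the columns forces equality of the prefix sums
   of each row, because the greedy matrix dominates row by row. *)
Lemma greedy_mx_unique (A : 'M[nat]_(m, n)) : bounded_mx r b A ->
  mx_dominated (greedy_mx n r b) A -> greedy_mx n r b = A.
Proof.
move=> Ab MA.
have row_eq (i : 'I_m) k :
    \sum_(j < n | j < k) A i j = \sum_(j < n | j < k) greedy_mx n r b i j.
  rewrite greedy_mx_row //.
  case: (posnP k) => [->|k0]; first by rewrite big_pred0_eq; lia.
  apply: (eq_of_leq_sum (F := fun i => \sum_(j < n | j < k) A i j)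
    (G := fun i => minn (r * k) (tnth b i))) => [i'|]; first exact: row_psum_le.
  by rewrite -psum_greedy_mx -psum_col_sums; exact: MA.
(* An entry is the difference of two consecutive prefix sums of its row. *)
apply/matrixP=> i j; have := row_eq i j; have := row_eq i j.+1.
have split (F : 'I_n -> nat) :
    \sum_(j' < n | j' < j.+1) F j' = F j + \sum_(j' < n | j' < j) F j'.
  rewrite (bigD1 j) ?ltnSn //=; congr (_ + _); apply: eq_bigl => j'.
  by rewrite ltnS ltn_neqAle andbC.
by rewrite !split; lia.
Qed.

(** The greedy matrix dominates every bounded matrix, so a maximal one must dominate it in turn, and
    [greedy_mx_unique] applies. *)
Lemma is_bB_greedy : is_bB r b (col_sums (greedy_mx n r b)).
Proof.
exists (greedy_mx n r b) => //; split.
  split=> [|A Ab _ k _]; first exact: greedy_mx_bounded.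
  by rewrite psum_greedy_mx psum_col_sums_le.
move=> A [Ab Amax]; apply: greedy_mx_unique => //; apply: Amax => [|k _].
  exact: greedy_mx_bounded.
by rewrite psum_greedy_mx psum_col_sums_le.
Qed.

End Greedy.

(** * Moving units to reach prescribed column sums *)

Lemma sum_indicator (I : finType) (i0 : I) (B : bool) :
  \sum_(i : I) ((i == i0) && B) = B.
Proof.
by rewrite (bigD1 i0) //= eqxx big1 ?addn0 // => i /negbTE ->.
Qed.

(* Let [q] be the first column whose sum is too small and [p < q] a column whose
   sum is too large.  Column [p] is heavier than column [q], hence it is so in
   some row, where a unit can be moved from [p] to [q]. *)
Lemma bounded_mx_col_sums (m n r : nat) (a : n.-tuple nat) (b : m.-tuple nat)
    (A : 'M[nat]_(m, n)) :
    nonincreasing a -> \sum_(j < n) tnth a j = \sum_(i < m) tnth b i ->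
    bounded_mx r b A -> dominated a (col_sums A) ->
  exists2 A' : 'M[nat]_(m, n), bounded_mx r b A' & col_sums A' = a.
Proof.
move=> a_noninc sum_ab.
(* The induction is on the total shortage of the columns that are too small. *)
pose deficit (A : 'M[nat]_(m, n)) :=
  \sum_(j < n) (tnth a j - tnth (col_sums A) j).
have [N] := ubnP (deficit A); elim: N A => // N IH A defA Ab aA.
set c := col_sums A in aA.
have sum_ac : \sum_(j < n) tnth a j = \sum_(j < n) tnth c j.
  rewrite sum_ab; under [RHS]eq_bigr do rewrite tnth_mktuple.
  by rewrite exchange_big; apply: eq_bigr => i _; case: Ab.
have [/existsP[q0 q0P]|no_def] := boolP [exists q, tnth c q < tnth a q]; last first.
  exists A => //; apply: eq_from_tnth => j; apply/esym; move: j.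
  apply: (eq_of_leq_sum (F := tnth a) (G := tnth c)) => [j'|].
    by rewrite leqNgt; apply: contra no_def => ?; apply/existsP; exists j'.
  by rewrite sum_ac.
case: (@arg_minnP _ q0 (fun q => tnth c q < tnth a q) (fun q : 'I_n => q : nat) q0P).
move=> q qP q_min.
have before (j : 'I_n) : j < q -> tnth a j <= tnth c j.
  by move=> jq; rewrite leqNgt; apply/negP => /q_min; lia.
(* Otherwise the prefix sum of [a] at [q.+1] would exceed that of [c], against [aA]. *)
have [p pq pP] : exists2 p : 'I_n, p < q & tnth a p < tnth c p.
  have [/existsP[p /andP[]]|none] :=
    boolP [exists p : 'I_n, (p < q) && (tnth a p < tnth c p)]; first by exists p.
  have := aA q.+1 isT; rewrite !psum_tuple.
  rewrite (bigD1 q) //= [leqRHS](bigD1 q) //= leqNgt => /negP[].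
  rewrite -addSn leq_add //; apply: leq_sum => j /andP[jq jNq].
  rewrite leqNgt; apply: contra none => ?; apply/existsP; exists j.
  by rewrite -val_eqE /= in jNq; lia.
have acpq : tnth c q < tnth c p.
  have := nonincreasing_nth a_noninc (ltnW pq); rewrite -!tnth_nth.
  by lia.
have [i0 i0P] : exists i0, A i0 q < A i0 p.
  apply/existsP; apply: contraLR acpq => /existsPn le; rewrite -leqNgt.
  by rewrite !tnth_mktuple leq_sum // => i _; rewrite leqNgt.
have pNq : p != q by rewrite -val_eqE /=; lia.
pose A' : 'M[nat]_(m, n) := (\matrix_(i, j)
  (A i j + ((i == i0) && (j == q)) - ((i == i0) && (j == p)))%N)%R.
(* The subtraction does not truncate, as [A i0 p > A i0 q] makes [A i0 p] positive. *)
have A'E i (j : 'I_n) :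
    A' i j + ((i == i0) && (j == p)) = A i j + ((i == i0) && (j == q)).
  rewrite mxE subnK //; case: eqP => // ->; case: eqP => //= ->; lia.
have cE j : tnth (col_sums A') j + (j == p) = tnth c j + (j == q).
  rewrite !tnth_mktuple -(sum_indicator i0 (j == p)).
  rewrite -(sum_indicator i0 (j == q)) -!big_split.
  by apply: eq_bigr => i _; exact: A'E.
have psum_A' k : psum (col_sums A') k + (p < k) = psum c k + (q < k).
  rewrite !psum_tuple -(sum_indicator p (p < k)) -(sum_indicator q (q < k)).
  rewrite !(big_mkcond (fun j : 'I_n => j < k)) -!big_split /=.
  apply: eq_bigr => j _; have := cE j.
  case: (eqVneq j p) => [<-|_]; case: (eqVneq j q) => [<-|_];
    by case: (ltnP j k) => /=; lia.
apply: (IH A').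
- rewrite -ltnS (leq_trans _ defA) // ltnS /deficit.
  rewrite (bigD1 q) //= [ltnRHS](bigD1 q) //= -addSn leq_add //.
    by have := cE q; rewrite eqxx [q == p]eq_sym (negbTE pNq) -/c; lia.
  apply: leq_sum => j jNq; have := cE j; rewrite (negbTE jNq) -/c.
  by case: eqP => [->|_]; lia.
- have [Ab_row Ab_r] := Ab; split=> [i|i j].
    apply: (@addIn (i == i0)); rewrite -Ab_row.
    rewrite -{1}(sum_indicator p (i == i0)) -(sum_indicator q (i == i0)).
    by rewrite -!big_split; apply: eq_bigr => j _; rewrite /= andbC A'E andbC.
  have := A'E i j; have := Ab_r i j.
  case: (eqVneq i i0) => [->|_] /=; last by lia.
  have := Ab_r i0 p; case: (eqVneq j q) => [->|_]; last by lia.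
  by rewrite [q == p]eq_sym (negbTE pNq); lia.
(* Prefix sums change only for [p < k <= q], where they drop by one; there [pP] and [before] make
   the old domination strict. *)
move=> k k0; have := aA k k0; have := psum_A' k.
have [pk|] := ltnP p k; last by have := ltn_trans pq; lia.
have [|kq] := ltnP q k; first by lia.
suff : psum a k < psum c k by lia.
rewrite !psum_tuple (bigD1 p) //= [ltnRHS](bigD1 p) //= -addSn leq_add //.
by apply: leq_sum => j /andP[jk _]; apply: before; exact: leq_trans kq.
Qed.

(** * Multigraphs as matrices of multiplicities *)

Section Multigraph.

Variables n m : nat.

Lemma ldegreeE (G : bip_multigraph n m) i :
  ldegree G i = \sum_(j < m) multiplicity G i j.
Proof.
rewrite /ldegree -sum1_card (partition_big (@rend _ _ G) xpredT) //=.
apply: eq_bigr => j _; rewrite /multiplicity -sum1_card.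
by apply: eq_bigl => e; rewrite !inE.
Qed.

Lemma rdegreeE (G : bip_multigraph n m) j :
  rdegree G j = \sum_(i < n) multiplicity G i j.
Proof.
rewrite /rdegree -sum1_card (partition_big (@lend _ _ G) xpredT) //=.
apply: eq_bigr => i _; rewrite /multiplicity -sum1_card.
by apply: eq_bigl => e; rewrite !inE andbC.
Qed.

(** An edge is a pair of endpoints with a label below their multiplicity; matrix rows are right
    vertices, hence [A p.2 p.1]. *)
Definition multigraph_of_mx (A : 'M[nat]_(m, n)) : bip_multigraph n m :=
  @BipMultigraph n m {p : 'I_n * 'I_m & 'I_(A p.2 p.1)}
    (fun e => (tag e).1) (fun e => (tag e).2).

Lemma multiplicity_of_mx (A : 'M[nat]_(m, n)) i j :
  multiplicity (multigraph_of_mx A) i j = A j i.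
Proof.
rewrite /multiplicity -sum1_card.
transitivity (\sum_(p : 'I_n * 'I_m | p == (i, j)) \sum_(x < A p.2 p.1) 1).
  rewrite sig_big_dep /=; apply: eq_bigl => -[[i' j'] x] /=.
  by rewrite !inE /= andbT xpair_eqE.
by rewrite big_pred1_eq sum1_card card_ord.
Qed.

Lemma multigraph_mxP (r : nat) (a : n.-tuple nat) (b : m.-tuple nat) :
  (exists G : bip_multigraph n m, is_r_multigraph r G /\ has_degrees G a b) <->
  (exists2 A : 'M[nat]_(m, n), bounded_mx r b A & col_sums A = a).
Proof.
split=> [[G [Gr [Ga Gb]]]|[A [Ab Ar] Aa]].
  exists (\matrix_(j, i) multiplicity G i j)%R.
    split=> [j|j i]; last by rewrite mxE.
    by rewrite -Gb rdegreeE; apply: eq_bigr => i _; rewrite mxE.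
  apply: eq_from_tnth => i; rewrite tnth_mktuple -Ga ldegreeE.
  by apply: eq_bigr => j _; rewrite mxE.
exists (multigraph_of_mx A); split=> [i j|]; first by rewrite multiplicity_of_mx.
split=> [i|j].
  rewrite ldegreeE -Aa tnth_mktuple.
  by apply: eq_bigr => j _; rewrite multiplicity_of_mx.
by rewrite rdegreeE -Ab; apply: eq_bigr => i _; rewrite multiplicity_of_mx.
Qed.

End Multigraph.

Theorem theorem3p6 (r n m : nat) (a : n.-tuple nat) (b : m.-tuple nat)
    (r_ge1 : 1 <= r)
    (a_noninc : nonincreasing a)
    (b_max : \max_(i < m) tnth b i <= r * n)
    (sum_eq : \sum_(i < n) tnth a i = \sum_(i < m) tnth b i) :
  [<-> (* 1 *) exists G : bip_multigraph n m,
         is_r_multigraph r G /\ has_degrees G a b;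
       (* 2 *) exists bB : n.-tuple nat, is_bB r b bB /\ dominated a bB;
       (* 3 *) forall k, 1 <= k <= n -> ineqB r a b k;
       (* 4 *) forall k, corner a k ->
         below_ratio k (\max_(i < m) tnth b i) r -> ineqB r a b k;
       (* 5 *) forall j, conj_corner a j ->
         below_ratio (conj_seq a j) (\max_(i < m) tnth b i) r ->
         j * conj_seq a j + conj_tail a j
           <= \sum_(1 <= i < (r * conj_seq a j).+1) conj_seq b i].
Proof.
(* Once [r * k] reaches every [b_i], the right side of (B_k) is the whole sum of [b], hence of
   [a]. *)
have trivial_ineqB k : \max_(i < m) tnth b i <= r * k -> ineqB r a b k.
  move=> bk; rewrite /ineqB psum_tuple.
  under [leqRHS]eq_bigr => i _.
    have /minn_idPr -> : tnth b i <= r * k by exact: leq_trans (leq_bigmax i) bk.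
    over.
  by rewrite -sum_eq [leqRHS](bigID (fun i : 'I_n => i < k)) leq_addr.
have sum_conj_b k :
    \sum_(1 <= i < (r * k).+1) conj_seq b i = \sum_(i < m) minn (r * k) (tnth b i).
  rewrite sum_conj_seq big_tuple.
  by apply: eq_bigr => i _; exact: sum_leq_indicator.
tfae.
- case/multigraph_mxP => A Ab <-; exists (col_sums (greedy_mx n r b)).
  split; first exact: is_bB_greedy.
  by move=> k _; rewrite psum_greedy_mx // psum_col_sums_le.
- case=> _ [[M [[Mb _] _] ->] aM] k /andP[k0 _].
  exact: leq_trans (aM k k0) (psum_col_sums_le k Mb).
- by move=> B k /andP[kn _] _; apply: B; rewrite size_tuple in kn.
- move=> B j jc jlt; have /andP[j0 _] := jc.
  rewrite -psum_conj_seq // sum_conj_b.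
  by apply: B => //; exact: corner_conj_seq.
(* The cycle closes through (4), then (B_k) for every [k], then a matrix with column sums [a]. *)
- move=> B5; have B4 k : corner a k -> r * k < \max_(i < m) tnth b i -> ineqB r a b k.
    move=> kc klt; have [jc jk] := conj_corner_term a_noninc kc.
    have /andP[j0 _] := jc.
    have := B5 _ jc; rewrite -psum_conj_seq // jk sum_conj_b; apply.
    exact/below_ratioP.
  (* The greedy column sums, extended to all [j]; that they are nonincreasing is the concavity of
     the right side of (B_k). *)
  pose t j := \sum_(i < m) minn r (tnth b i - r * j).
  have sum_t k : \sum_(j < k) t j = \sum_(i < m) minn (r * k) (tnth b i).
    by rewrite exchange_big; apply: eq_bigr => i _; exact: sum_minn_sub.
  have B3 k : ineqB r a b k.
    have [kn|nk] := leqP k n; last first.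
      by apply: trivial_ineqB; apply: leq_trans b_max _; rewrite leq_mul2l ltnW ?orbT.
    rewrite /ineqB psum_ord -sum_t.
    apply: (leq_sum_from_drops (s := nth 0 a) _ _ _ _ kn).
    + by move=> x y; exact: nonincreasing_nth.
    + by move=> x y xy; apply: leq_sum => i _; have := leq_mul (leqnn r) xy; lia.
    + by rewrite sum_t -psum_ord; exact: trivial_ineqB.
    (* A drop from index [l.-1] to [l], counted from 0, is a corner at [l] counted from 1. *)
    move=> l /andP[l0 ln] drop; rewrite sum_t -psum_ord.
    have [|lt] := leqP (\max_(i < m) tnth b i) (r * l); first exact: trivial_ineqB.
    by apply: B4 => //; rewrite /corner l0 size_tuple ltnW.
  apply/multigraph_mxP; apply: (bounded_mx_col_sums (A := greedy_mx n r b)) => //.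
    exact: greedy_mx_bounded.
  by move=> k _; rewrite psum_greedy_mx //; exact: B3.
Qed.
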